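(* Let $\Sigma=(X,U,P,\mathcal P,\varsigma,F)$ be an interconnected discrete-time stochastic switching system without disturbance signals, with initial set $X_0\subseteq X$ and unsafe set $X_u\subseteq X$. Suppose $\mathcal B(x,p)$ is a stochastic control barrier certificate (CBC) for $\Sigma$, with constants $0<\kappa<1$ and $\gamma,\lambda,\psi\in\mathbb R_{\ge 0}$, $\lambda>\gamma$. Then the probability that the solution process of $\Sigma$ starting from any initial state $a\in X_0$ and any initial mode $p_0$ reaches $X_u$ under $\nu(\cdot)$ within the time step $k\in[0,\mathcal T]$ is bounded as $$\mathbb P^{a}_{\nu}\Big\{x^p(k)\in X_u \text{ for some } 0\le k\le \mathcal T \,\Big|\, x^p(0)=a,\ p_0\Big\}\le \delta,$$ where $$\delta=\begin{cases}1-\left(1-\frac{\gamma}{\lambda}\right)\left(1-\frac{\psi}{\lambda}\right)^{\mathcal T}, & \text{if } \lambda\ge \frac{\psi}{1-\kappa},\\[4pt] \frac{\gamma}{\lambda}\,\kappa^{\mathcal T}+\frac{\psi}{(1-\kappa)\lambda}\left(1-\kappa^{\mathcal T}\right), & \text{if } \lambda<\frac{\psi}{1-\kappa}.\end{cases}$$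
   Context: An interconnected discrete-time stochastic switching system without disturbances, composed of $N$ subsystems with finite mode sets $P_i=\{1,\dots,m_i\}$, is a tuple $\Sigma=(X,U,P,\mathcal P,\varsigma,F)$ where $X\subseteq\mathbb R^n$ (state space) and $U\subseteq\mathbb R^{\bar m}$ (input space) are Borel spaces; $P=\prod_{i=1}^N P_i$ is the finite set of modes, with $M=\prod_{i=1}^N m_i$ elements (indexed $1,\dots,M$ in sums); $\mathcal P$ is a set of functions $\mathbb N\to P$ (switching signals); $\varsigma=\{\varsigma(k)\}_{k\in\mathbb N}$ is a sequence of i.i.d. random variables with values in a measurable space $\mathcal V_\varsigma$; and $F=\{f_p\}_{p\in P}$ is a family of measurable maps $f_p:X\times U\times\mathcal V_\varsigma\to X$. The evolution is $$x(k+1)=f_{\mathbf p(k)}(x(k),\nu(k),\varsigma(k)),\qquad k\in\mathbb N,$$ where $\nu(k)$ is the ($U$-valued, random) input, independent of $\varsigma(z)$ for all $z\ge k$, and $\mathbf p(k)$ is the switching signal. The switching between modes is Markovian: $\mathbb P\{\mathbf p(k+1)=p'\mid \mathbf p(k)=p\}=\pi_{pp'}$, with $\pi_{pp'}\ge 0$ and $\sum_{p'}\pi_{pp'}=1$. The controller has access to the switching mode and to the full state. The solution process under the input $\nu(\cdot)$ and switching signal $p$ is denoted $x^p(\cdot)$, and $\mathbb P^a_\nu$ is the probability for the process started at $a$ under $\nu(\cdot)$. Control barrier certificate (CBC): given $X_0,X_u\subseteq X$ (initial and unsafe sets), a function $\mathcal B:X\times P\to\mathbb R_{\ge 0}$ is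 a stochastic control barrier certificate for $\Sigma$ if, for all $p\in P$, (i) $\mathcal B(x,p)\le\gamma$ for all $x\in X_0$; (ii) $\mathcal B(x,p)\ge\lambda$ for all $x\in X_u$; (iii) for every $x:=x(k)\in X$ there exists $\nu:=\nu(k)\in U$ such that $$\sum_{p'=1}^{M}\pi_{pp'}\,\mathbb E\big[\mathcal B(x(k+1),p')\,\big|\,x,\nu,p\big]\le \kappa\,\mathcal B(x,p)+\psi ,$$ for some $0<\kappa<1$ and $\gamma,\lambda,\psi\in\mathbb R_{\ge0}$ with $\lambda>\gamma$. *)

(* Defs.v *)
From HB Require Import structures.
From mathcomp Require Import all_boot all_order all_algebra.
From mathcomp Require Import all_classical all_reals all_analysis.

Set Implicit Arguments.
Unset Strict Implicit.
Unset Printing Implicit Defensive.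

Import Order.TTheory GRing.Theory Num.Theory.
Import numFieldNormedType.Exports.

Local Open Scope classical_set_scope.
Local Open Scope ring_scope.

(* R^n with its Borel sigma-algebra. *)
Notation borelRn R n := (g_sigma_algebraType (@open 'rV[R]_n)).

(* The product P = P_1 x ... x P_N; the mode set {1, ..., m_i} is rendered by
   the ordinals 'I_(m i). *)
Notation modes m := {dffun forall i, 'I_(m i)}.

Section Probability.
Context d (Omega : measurableType d) (R : realType) (Pr : probability Omega R).

Definition indep_systems (F G : set (set Omega)) : Prop :=
  forall A B, F A -> G B -> Pr (A `&` B) = (Pr A * Pr B)%E.

Definition cond_prob (A B : set Omega) : R := fine (Pr (A `&` B)) / fine (Pr B).

Context dV (V : measurableType dV).

(* The events of the form {X in C}, C measurable. *)
Definition events_of (X : Omega -> V) : set (set Omega) :=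
  preimage_set_system setT X measurable.

Definition mutually_independent (X : nat -> {RV Pr >-> V}) : Prop :=
  forall (s : seq nat) (C : nat -> set V), uniq s ->
    (forall j, measurable (C j)) ->
    Pr (\big[setI/setT]_(j <- s) (X j @^-1` C j)) =
    (\prod_(j <- s) Pr (X j @^-1` C j))%E.

Definition identically_distributed (X : nat -> {RV Pr >-> V}) : Prop :=
  forall (j k : nat) (C : set V), measurable C ->
    distribution Pr (X j) C = distribution Pr (X k) C.

End Probability.

(* The state and input spaces are Borel subsets of R^n and R^mbar; the maps f_p
   and their measurability are only constrained on X x U x V.  The transition
   probabilities of the switching are part of the data. *)
Record switching_system d (Omega : measurableType d) (R : realType)
    (Pr : probability Omega R) dV (V : measurableType dV)
    (n mbar N : nat) (m : 'I_N -> nat) := SwitchingSystem {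
  ss_X : set (borelRn R n) ;
  ss_U : set (borelRn R mbar) ;
  ss_signals : set (nat -> modes m) ;
  ss_noise : nat -> {RV Pr >-> V} ;
  ss_f : modes m -> borelRn R n -> borelRn R mbar -> V -> borelRn R n ;
  ss_pi : modes m -> modes m -> R ;
  ss_measurable_X : measurable ss_X ;
  ss_measurable_U : measurable ss_U ;
  ss_noise_indep : mutually_independent ss_noise ;
  ss_noise_id : identically_distributed ss_noise ;
  ss_f_X : forall q x u s, ss_X x -> ss_U u -> ss_X (ss_f q x u s) ;
  ss_measurable_f : forall q,
    measurable_fun ((ss_X `*` ss_U) `*` [set: V])
      (fun z => ss_f q z.1.1 z.1.2 z.2) ;
  ss_pi_ge0 : forall q q', 0 <= ss_pi q q' ;
  ss_pi_sum1 : forall q, \sum_(q' : modes m) ss_pi q q' = 1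
}.

Section System.
Context d (Omega : measurableType d) (R : realType) (Pr : probability Omega R).
Context dV (V : measurableType dV) (n mbar N : nat) (m : 'I_N -> nat).
Variable Sigma : switching_system Pr V n mbar m.

(* Under the constant values x(k) = x, nu(k) = u, p(k) = q the next state is
   f_q(x, u, noise(k)), whence the conditional expectation of B(x(k+1), q')
   given (x, u, q) is the expectation over noise(k) below.  It is an extended
   real: it may be +oo a priori. *)
Definition cbc_step (B : borelRn R n -> modes m -> R) (kappa psi : R)
    (k : nat) (q : modes m) (x : borelRn R n) (u : borelRn R mbar) : Prop :=
  (\sum_(q' : modes m) (ss_pi Sigma q q')%:E *
      'E_Pr[fun w => B (ss_f Sigma q x u (ss_noise Sigma k w)) q']
   <= (kappa * B x q + psi)%:E)%E.

(* Measurability of B(., q) on X is what makes the expectations meaningful. *)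
Record is_CBC (X0 Xu : set (borelRn R n)) (B : borelRn R n -> modes m -> R)
    (kappa gamma lambda psi : R) : Prop := IsCBC {
  cbc_kappa : 0 < kappa < 1 ;
  cbc_gamma : 0 <= gamma ;
  cbc_lambda : 0 <= lambda ;
  cbc_psi : 0 <= psi ;
  cbc_gap : gamma < lambda ;
  cbc_ge0 : forall x q, ss_X Sigma x -> 0 <= B x q ;
  cbc_measurable : forall q, measurable_fun (ss_X Sigma) (fun x => B x q) ;
  cbc_init : forall q x, X0 x -> B x q <= gamma ;
  cbc_unsafe : forall q x, Xu x -> lambda <= B x q ;
  cbc_drift : forall q k x, ss_X Sigma x ->
    exists2 u, ss_U Sigma u & cbc_step B kappa psi k q x u
}.

Variables (nu : nat -> {RV Pr >-> borelRn R mbar}) (p : Omega -> nat -> modes m).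

Fixpoint solution (a : borelRn R n) (k : nat) (w : Omega) : borelRn R n :=
  if k is j.+1 then
    ss_f Sigma (p w j) (solution a j w) (nu j w) (ss_noise Sigma j w)
  else a.

(* The events generating the past at time k, when nu(k) has been chosen and
   noise(k) has not been drawn yet: nu(j), p(j) for j <= k, noise(j) for j < k.
   The states x(j), j <= k, are functions of these. *)
Definition past_gen (k : nat) : set (set Omega) :=
  \bigcup_(j in [set j | (j <= k)%N])
     (events_of (nu j) `|` preimage_set_system setT (p^~ j) setT)
  `|` \bigcup_(j in [set j | (j < k)%N]) events_of (ss_noise Sigma j).

(* Independence of nu(k) from noise(z), z >= k, concerns the whole past: that
   of nu(k) alone would allow nu(k) to reveal noise(k) jointly with x(k).
   Likewise the Markov property is relative to the past and to noise(k), i.e.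
   Pr(p(k+1) = q' | p(k) = q, A) = pi_{q q'} in product form. *)
Record admissible : Prop := Admissible {
  adm_signal : forall w, ss_signals Sigma (p w) ;
  adm_measurable_mode : forall k q, measurable [set w | p w k = q] ;
  adm_input : forall k w, ss_U Sigma (nu k w) ;
  adm_indep : forall k z, (k <= z)%N ->
    indep_systems Pr <<s past_gen k >> (events_of (ss_noise Sigma z)) ;
  adm_markov : forall k A q q',
    <<s past_gen k `|` events_of (ss_noise Sigma k) >> A ->
    Pr (A `&` [set w | p w k = q] `&` [set w | p w k.+1 = q']) =
    ((ss_pi Sigma q q')%:E * Pr (A `&` [set w | p w k = q]))%E
}.

(* nu(k) is almost surely an input whose existence is asserted by cbc_drift at
   the current state and mode. *)
Definition realizes_CBC (B : borelRn R n -> modes m -> R) (kappa psi : R)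
    (a : borelRn R n) : Prop :=
  forall k, {ae Pr, forall w,
    cbc_step B kappa psi k (p w k) (solution a k w) (nu k w)}.

Definition reach (Xu : set (borelRn R n)) (a : borelRn R n) (T : nat) :
    set Omega :=
  [set w | exists2 k, (k <= T)%N & Xu (solution a k w)].

End System.

Definition delta (R : realType) (kappa gamma lambda psi : R) (T : nat) : R :=
  if psi / (1 - kappa) <= lambda then
    1 - (1 - gamma / lambda) * (1 - psi / lambda) ^+ T
  else
    gamma / lambda * kappa ^+ T
    + psi / ((1 - kappa) * lambda) * (1 - kappa ^+ T).

(* Main.v *)
(* The set X_u lies in {B >= lambda}, so it suffices to bound the probability that
   B(x(k), p(k)) reaches lambda.  In both regimes delta is v_T(gamma) for affine
   functions v_j(b) = al_j b + be_j with nonnegative coefficients such that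
   v_j >= 1 on [lambda, +oo[ and v_j(kappa b + psi) <= v_(j+1)(b) for b >= 0.
   Averaging the drift inequality over any event K of the past at time k gives
   E[v_j(B(k+1)); K] <= E[v_(j+1)(B(k)); K]; splitting K according to whether
   B(k+1) >= lambda, induction on the horizon j gives
   Pr(K, lambda is reached at some time in ]k, k+j]) <= E[v_j(B(k)); K]. *)
From HB Require Import structures.
Require Import Defs.
From mathcomp Require Import all_boot all_order all_algebra.
From mathcomp Require Import all_classical all_reals all_analysis.
From mathcomp Require Import measurable_realfun lra ring.

Set Implicit Arguments.
Unset Strict Implicit.
Unset Printing Implicit Defensive.

Import Order.TTheory GRing.Theory Num.Theory.
Import numFieldNormedType.Exports.

Local Open Scope classical_set_scope.
Local Open Scope ring_scope.

(** * Finite selections, sub-sigma-algebras, and freezing of the past under independence *)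

Section MeasureTheory.
Local Open Scope ereal_scope.

(** The selector enters only through its level sets, which spares equipping the modes with a
    sigma-algebra; a preimage is a finite union over the values of [p]. *)
Lemma measurable_fun_select (I : finType) d d' (T : measurableType d)
    (T' : measurableType d') (p : T -> I) (g : I -> T -> T') :
  (forall i, measurable [set t | p t = i]) ->
  (forall i, measurable_fun setT (g i)) ->
  measurable_fun setT (fun t => g (p t) t).
Proof.
move=> mp mg _ Y mY; rewrite setTI.
have -> : (fun t => g (p t) t) @^-1` Y =
    \big[setU/set0]_(i <- enum I) ([set t | p t = i] `&` g i @^-1` Y).
  rewrite -bigcup_seq; apply/seteqP; split=> [t gY|t [i _ [<-]]//].
  by exists (p t) => //=; rewrite mem_enum.
apply: bigsetU_measurable => i _; apply: measurableI => //.
by rewrite -[X in measurable X]setTI; exact: mg.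
Qed.

Lemma ge0_integral_partition (I : finType) d (T : measurableType d)
    (R : realType) (mu : {measure set T -> \bar R}) (p : T -> I) (K : set T)
    (f : T -> \bar R) :
  (forall i, measurable [set t | p t = i]) -> measurable K ->
  measurable_fun setT f -> (forall t, 0 <= f t) ->
  \int[mu]_(t in K) f t = \sum_i \int[mu]_(t in K `&` [set t | p t = i]) f t.
Proof.
move=> mp mK mf f0.
have KE : K = \big[setU/set0]_(i <- enum I) (K `&` [set t | p t = i]).
  rewrite -bigcup_seq; apply/seteqP; split=> [t Kt|t [i _ []]//].
  by exists (p t) => //=; rewrite mem_enum.
rewrite {1}KE ge0_integral_bigsetU//=.
- by rewrite big_enum.
- by move=> i; exact: measurableI.
- exact: enum_uniq.
- by move=> i j _ _ [t [[_ <-] [_ <-]]].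
- exact: measurable_funTS.
Qed.

Context d (Omega : measurableType d) (R : realType) (Pr : probability Omega R).
Variables (G : set (set Omega)) (mG : G `<=` measurable).

Let sG : <<s G >> `<=` measurable.
Proof. by apply: smallest_sub => //; exact: sigma_algebra_measurable. Qed.

(** [g_sigma_algebraType G] has the points of [Omega] with possibly fewer measurable sets; functions
    are composed and measures pushed forward along this identity. *)
Let mid : measurable_fun setT (id : Omega -> g_sigma_algebraType G).
Proof. by move=> _ Y mY; rewrite setTI; exact: sG. Qed.

Lemma measurable_fun_sub_sigma d' (T : measurableType d')
    (f : g_sigma_algebraType G -> T) :
  measurable_fun setT f -> measurable_fun setT (f : Omega -> T).
Proof. by move=> mf; exact: (measurableT_comp mf mid). Qed.

(** The restricted measure has no mass outside [D] and equals [mu] on subsets of [D]. It can be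
    pushed forward to [<<s G>>] even when [D] is not in [<<s G>>]. *)
Lemma ge0_integral_mrestr d' (T : measurableType d')
    (mu : {measure set T -> \bar R}) (D : set T) (mD : measurable D)
    (f : T -> \bar R) :
  measurable_fun setT f -> (forall t, 0 <= f t) ->
  \int[mrestr mu mD]_t f t = \int[mu]_(t in D) f t.
Proof.
move=> mf f0; rewrite -(setUv D) ge0_integral_setU//; last 3 first.
- exact: measurableC.
- by rewrite setUv.
- by rewrite disj_set2E setICr.
rewrite [X in _ + X]null_set_integral ?adde0//.
- by apply: eq_measure_integral => A mA AD; rewrite /= /mrestr setIidl.
- exact: measurableC.
- exact: measurable_funTS.
- by rewrite /= /mrestr setICl measure0.
Qed.

(* The two set functions agree on <<s G>> up to the factor c, so integrals of
   <<s G>>-measurable functions do too; this is how the Markov property enters. *)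
Lemma integral_proportional (D D' : set Omega) (c : R)
    (f : g_sigma_algebraType G -> \bar R) :
  measurable D -> measurable D' -> (0 <= c)%R ->
  (forall A, <<s G >> A -> Pr (A `&` D') = c%:E * Pr (A `&` D)) ->
  measurable_fun setT f -> (forall w, 0 <= f w) ->
  \int[Pr]_(w in D') f w = c%:E * \int[Pr]_(w in D) f w.
Proof.
move=> mD mD' c0 DD' mf f0.
have mu (E : set Omega) (mE : measurable E) :
    \int[pushforward (mrestr Pr mE) (id : Omega -> g_sigma_algebraType G)]_w f w
    = \int[Pr]_(w in E) f w.
  rewrite ge0_integral_pushforward//= preimage_id ge0_integral_mrestr//.
  exact: measurable_fun_sub_sigma.
rewrite -(mu _ mD) -(mu _ mD') -[c]/((NngNum c0)%:num) -ge0_integral_mscale//.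
apply: eq_measure_integral => A mA _.
by rewrite /= /mscale /= /pushforward /mrestr /= DD'.
Qed.

(* By independence, the law of (w, Y w) on (Omega, <<s G>>) x V is a product
   measure. *)
Lemma integral_freezeT dV (V : measurableType dV) (Y : {RV Pr >-> V})
    (h : g_sigma_algebraType G * V -> \bar R) :
  indep_systems Pr <<s G >> (events_of Y) ->
  measurable_fun setT h -> (forall z, 0 <= h z) ->
  \int[Pr]_w h (w, Y w) = \int[Pr]_w \int[Pr]_w' h (w, Y w').
Proof.
move=> GY mh h0.
pose X : {mfun Omega >-> g_sigma_algebraType G} :=
  HB.pack (id : Omega -> g_sigma_algebraType G) (isMeasurableFun.Build _ _ _ _ _ mid).
have mZ : measurable_fun setT (fun w => (X w, Y w)).
  exact: measurable_fun_pair.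
pose Z : {mfun Omega >-> (g_sigma_algebraType G * V)%type} :=
  HB.pack (fun w => (X w, Y w)) (isMeasurableFun.Build _ _ _ _ _ mZ).
transitivity (\int[distribution Pr Z]_z h z).
  by rewrite ge0_integral_distribution.
transitivity (\int[distribution Pr X \x distribution Pr Y]_z h z).
  (* The product measure is determined by its values on rectangles, where the required equality is
     [GY]. *)
  apply: eq_measure_integral => A mA _; apply/esym.
  apply: product_measure_unique => // {mA}A C mA mC /=.
  by rewrite /distribution /pushforward -GY//; exists C; rewrite ?setTI.
rewrite fubini_tonelli1// ge0_integral_distribution//=; last 2 first.
- exact: measurable_fun_fubini_tonelli_F.
- by move=> w; apply: integral_ge0.
apply: eq_integral => w _; rewrite /fubini_F ge0_integral_distribution//.
exact: measurable_fun_pair2.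
Qed.

(** Since [K] lies in [<<s G>>], it can be absorbed into [h] as a condition on the first
    coordinate. *)
Lemma integral_freeze dV (V : measurableType dV) (Y : {RV Pr >-> V})
    (K : set Omega) (h : g_sigma_algebraType G * V -> \bar R) :
  indep_systems Pr <<s G >> (events_of Y) -> <<s G >> K ->
  measurable_fun setT h -> (forall z, 0 <= h z) ->
  \int[Pr]_(w in K) h (w, Y w) =
  \int[Pr]_(w in K) \int[Pr]_w' h (w, Y w').
Proof.
move=> GY GK mh h0.
have mK : measurable (K `*` setT : set (g_sigma_algebraType G * V)).
  exact: measurableX.
rewrite integral_mkcond [RHS]integral_mkcond.
pose hK : g_sigma_algebraType G * V -> \bar R := h \_ (K `*` setT).
transitivity (\int[Pr]_w hK (w, Y w)).
  by apply: eq_integral => w _; rewrite /hK !patchE in_setX in_setT andbT.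
rewrite (@integral_freezeT _ _ Y hK)//.
- apply: eq_integral => w _; rewrite patchE; case: ifPn => wK.
    by apply: eq_integral => v _; rewrite /hK patchE in_setX in_setT andbT/= wK.
  by rewrite integral0_eq// => v _; rewrite /hK patchE in_setX (negbTE wK).
- by apply: (measurable_restrictT h mK).1; exact: measurable_funTS.
- by move=> z; rewrite /hK patchE; case: ifP.
Qed.

End MeasureTheory.

(** * The solution process is adapted to the past *)

Section System.
Context d (Omega : measurableType d) (R : realType) (Pr : probability Omega R).
Context dV (V : measurableType dV) (n mbar N : nat) (m : 'I_N -> nat).
Context (Sigma : switching_system Pr V n mbar m).

(** The maps [ss_f] are measurable only on X x U x V, so the composition goes through that domain;
    hence the range hypotheses on [x] and [u]. *)
Lemma measurable_step dT (T : measurableType dT) (q : modes m)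
    (x : T -> borelRn R n) (u : T -> borelRn R mbar) (s : T -> V) :
  measurable_fun setT x -> measurable_fun setT u -> measurable_fun setT s ->
  (forall t, ss_X Sigma (x t)) -> (forall t, ss_U Sigma (u t)) ->
  measurable_fun setT (fun t => ss_f Sigma q (x t) (u t) (s t)).
Proof.
move=> mx mu ms Xx Uu.
apply: (@measurable_comp _ _ _ _ _ _ ((ss_X Sigma `*` ss_U Sigma) `*` setT)
  (fun z => ss_f Sigma q z.1.1 z.1.2 z.2) _ (fun t => ((x t, u t), s t))).
- apply: measurableX => //; apply: measurableX.
    exact: ss_measurable_X.
  exact: ss_measurable_U.
- by move=> _ [t _ <-]; split=> //=.
- exact: ss_measurable_f.
- by apply: measurable_fun_pair => //; exact: measurable_fun_pair.
Qed.

Context (nu : nat -> {RV Pr >-> borelRn R mbar}) (p : Omega -> nat -> modes m).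
Context (hadm : admissible Sigma nu p).

Lemma past_measurable k : past_gen Sigma nu p k `<=` measurable.
Proof.
have RVm d' (T : measurableType d') (Y : {RV Pr >-> T}) :
    events_of Y `<=` measurable.
  by move=> _ [C mC <-]; exact: measurable_funPT.
move=> A [[j _ [/RVm//|[C _ <-]]]|[j _ /RVm//]].
have -> : setT `&` p^~ j @^-1` C = \bigcup_(q in C) [set w | p w j = q].
  by rewrite setTI; apply/seteqP; split=> [w Cw|w [q /[swap] /= <-]//]; exists (p w j).
apply: fin_bigcup_measurable => [|q _]; first exact: finite_finset.
exact: adm_measurable_mode hadm _ _.
Qed.

Lemma past_le k l : (k <= l)%N -> past_gen Sigma nu p k `<=` past_gen Sigma nu p l.
Proof.
move=> kl A [[j /= jk Aj]|[j /= jk Aj]]; [left|right]; exists j => //=.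
  exact: leq_trans kl.
exact: leq_trans kl.
Qed.

Lemma past_noise k :
  past_gen Sigma nu p k `|` events_of (ss_noise Sigma k) `<=`
  past_gen Sigma nu p k.+1.
Proof.
move=> A [|Ak]; first exact: past_le.
by right; exists k => //=.
Qed.

Section Adapted.
Variables (k : nat) (G : set (set Omega)).
Hypothesis kG : past_gen Sigma nu p k `<=` G.

Lemma adapted_mode j q : (j <= k)%N ->
  measurable ([set w | p w j = q] : set (g_sigma_algebraType G)).
Proof.
move=> jk; apply: sub_sigma_algebra; apply: kG; left; exists j => //=.
by right; exists [set q] => //; rewrite setTI.
Qed.

Lemma adapted_input j : (j <= k)%N ->
  measurable_fun setT (nu j : g_sigma_algebraType G -> borelRn R mbar).
Proof.
move=> jk _ C mC; apply: sub_sigma_algebra; apply: kG; left; exists j => //=.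
by left; exists C.
Qed.

Lemma adapted_noise j : (j < k)%N ->
  measurable_fun setT (ss_noise Sigma j : g_sigma_algebraType G -> V).
Proof.
move=> jk _ C mC; apply: sub_sigma_algebra; apply: kG; right; exists j => //=.
by exists C.
Qed.

End Adapted.

Context (a : borelRn R n) (Xa : ss_X Sigma a).
Notation x := (solution Sigma nu p a).

Lemma solution_X k w : ss_X Sigma (x k w).
Proof. by elim: k => //= k IH; apply: ss_f_X => //; exact: adm_input hadm _ _. Qed.

(** The family [G] is arbitrary above the past because the induction step reads x(k) in the larger
    past of time [k.+1]. *)
Lemma adapted_solution k (G : set (set Omega)) :
  past_gen Sigma nu p k `<=` G ->
  measurable_fun setT (x k : g_sigma_algebraType G -> borelRn R n).
Proof.
elim: k G => [|k IH] G kG /=; first exact: measurable_cst.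
apply: (@measurable_fun_select _ _ _ (g_sigma_algebraType G) _ (p^~ k)
  (fun q w => ss_f Sigma q (x k w) (nu k w) (ss_noise Sigma k w))) => q.
  exact (adapted_mode kG q (leqnSn k)).
apply: (@measurable_step _ (g_sigma_algebraType G) q (x k) (nu k)).
- by apply: IH; apply: subset_trans kG; exact: past_le.
- exact (adapted_input kG (leqnSn k)).
- exact (adapted_noise kG (ltnSn k)).
- by move=> w; exact: solution_X.
- by move=> w; exact: adm_input hadm _ _.
Qed.

(** * Averaging the barrier over one transition *)

Context (B : borelRn R n -> modes m -> R) (kappa gamma lambda psi : R).
Context (X0 Xu : set (borelRn R n)).
Context (hB : is_CBC Sigma X0 Xu B kappa gamma lambda psi).

Lemma measurable_barrier dT (T : measurableType dT) (q : modes m)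
    (y : T -> borelRn R n) :
  measurable_fun setT y -> (forall t, ss_X Sigma (y t)) ->
  measurable_fun setT (fun t => B (y t) q).
Proof.
move=> my Xy.
apply: (@measurable_comp _ _ _ _ _ _ (ss_X Sigma) (fun z => B z q)) => //.
- exact: ss_measurable_X.
- by move=> _ [t _ <-].
- exact: cbc_measurable hB _.
Qed.

Lemma adapted_barrier k (G : set (set Omega)) :
  past_gen Sigma nu p k `<=` G ->
  measurable_fun setT
    ((fun w => B (x k w) (p w k)) : g_sigma_algebraType G -> R).
Proof.
move=> kG.
apply: (@measurable_fun_select _ _ _ (g_sigma_algebraType G) _ (p^~ k)
  (fun q w => B (x k w) q)) => q.
  exact (adapted_mode kG q (leqnn k)).
apply: (@measurable_barrier _ (g_sigma_algebraType G)); last exact: solution_X.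
exact: adapted_solution.
Qed.

Lemma barrier_ge0 k w q : 0 <= B (x k w) q.
Proof. exact: cbc_ge0 hB _ _ (solution_X _ _). Qed.

Local Open Scope ereal_scope.

Lemma past_sigma_measurable k (A : set Omega) :
  <<s past_gen Sigma nu p k >> A -> measurable A.
Proof.
move: A; apply: smallest_sub; last exact: past_measurable.
exact: sigma_algebra_measurable.
Qed.

Lemma measurable_barrier_process k :
  measurable_fun setT (fun w => B (x k w) (p w k)).
Proof.
apply: (measurable_fun_sub_sigma (@past_measurable k)).
exact: adapted_barrier.
Qed.

(* z.1 is the past, read in the sub-sigma-algebra, and z.2 the fresh noise. *)
Let next_barrier k (q q' : modes m)
    (z : g_sigma_algebraType (past_gen Sigma nu p k) * V) : \bar R :=
  (B (ss_f Sigma q (x k z.1) (nu k z.1) z.2) q')%:E.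

Let next_X k q w s : ss_X Sigma (ss_f Sigma q (x k w) (nu k w) s).
Proof. by apply: ss_f_X; [exact: solution_X|exact: adm_input hadm _ _]. Qed.

Let next_barrier_ge0 k q q' z : 0 <= @next_barrier k q q' z.
Proof. by rewrite lee_fin; apply: cbc_ge0 hB _ _ _; exact: next_X. Qed.

Let measurable_next_barrier k q q' : measurable_fun setT (@next_barrier k q q').
Proof.
apply/measurable_EFinP; apply: measurable_barrier => [|z]; last exact: next_X.
apply: measurable_step => //.
- by apply: measurableT_comp => //; exact: adapted_solution.
- apply: measurableT_comp => //.
  exact (adapted_input (@subset_refl _ _) (leqnn k)).
- by move=> z; exact: solution_X.
- by move=> z; exact: adm_input hadm _ _.
Qed.

(** State and input stay at [w] while the noise is averaged over a separate [w']: this is the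
    expectation that [cbc_step] bounds. *)
Let expected_barrier k q q' w :=
  'E_Pr[fun w' => B (ss_f Sigma q (x k w) (nu k w) (ss_noise Sigma k w')) q'].

Let expected_barrier_ge0 k q q' w : 0 <= expected_barrier k q q' w.
Proof.
rewrite /expected_barrier unlock; apply: integral_ge0 => w' _.
exact: (next_barrier_ge0 q q' (w, _)).
Qed.

Let measurable_expected_barrier k q q' :
  measurable_fun setT (expected_barrier k q q').
Proof.
apply: (measurable_fun_sub_sigma (@past_measurable k)).
(* As a partial integral of [next_barrier] against the law of the noise, it is measurable in the
   past by Tonelli. *)
have -> : expected_barrier k q q' =
    fubini_F (distribution Pr (ss_noise Sigma k)) (@next_barrier k q q').
  apply/funext => w; rewrite /expected_barrier unlock /fubini_F.
  rewrite ge0_integral_distribution//.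
  exact: (measurable_fun_pair2 _ (@measurable_next_barrier k q q')).
exact: measurable_fun_fubini_tonelli_F.
Qed.

(** The Markov property first trades the event p(k+1) = q' for the factor [ss_pi]; it is used
    relative to the past and noise(k), since x(k+1) depends on both. Independence of noise(k) from
    the past then averages the noise. *)
Lemma integral_transition k (q q' : modes m) (D : set Omega) :
  <<s past_gen Sigma nu p k >> D -> D `<=` [set w | p w k = q] ->
  \int[Pr]_(w in D `&` [set w | p w k.+1 = q']) (B (x k.+1 w) (p w k.+1))%:E =
  (ss_pi Sigma q q')%:E *
  \int[Pr]_(w in D) expected_barrier k q q' w.
Proof.
move=> sD Dq; have mD := past_sigma_measurable sD.
have mq l s : measurable [set w | p w l = s] by exact: adm_measurable_mode hadm _ _.
set Y := ss_noise Sigma k; set h := @next_barrier k q q'.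
have h0 : forall z, 0 <= h z by exact: next_barrier_ge0.
have mh : measurable_fun setT h by exact: measurable_next_barrier.
transitivity (\int[Pr]_(w in D `&` [set w | p w k.+1 = q']) h (w, Y w)).
  apply: eq_integral => w; rewrite inE => -[/Dq /= wq wq'].
  by rewrite /h /next_barrier /= wq wq'.
transitivity ((ss_pi Sigma q q')%:E * \int[Pr]_(w in D) h (w, Y w)).
  pose G := past_gen Sigma nu p k `|` events_of Y.
  apply: (@integral_proportional _ _ _ _ G).
  - exact: (subset_trans (@past_noise k) (@past_measurable k.+1)).
  - by [].
  - exact: measurableI.
  - exact: ss_pi_ge0.
  - move=> A sA; rewrite setIA.
    (* This exposes the event p(k) = q that [adm_markov] conditions on. *)
    have DE : D = D `&` [set w | p w k = q] by rewrite setIidl.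
    rewrite DE setIA; apply: (adm_markov hadm).
    apply: (@measurableI _ (g_sigma_algebraType G)) => //.
    by apply: sub_sigma_algebra2 sD; left.
  - apply: (measurableT_comp mh).
    apply: measurable_fun_pair.
      move=> _ C mC; rewrite setTI.
      by apply: sub_sigma_algebra2 mC; left.
    move=> _ C mC; apply: sub_sigma_algebra; right; exists C => //.
  - by [].
congr (_ * _); rewrite integral_freeze//.
- by apply: eq_integral => w _; rewrite /expected_barrier unlock.
- exact: past_measurable.
- exact: adm_indep hadm _ _ _.
Qed.

(** Splitting over p(k) = q and then p(k+1) = q' reduces to [integral_transition]; summing over q'
    under the integral restores the left side of [cbc_step]. All integrands are nonnegative, so
    infinite values are harmless. *)
Lemma barrier_drift k (K : set Omega) :
  realizes_CBC Sigma nu p B kappa psi a ->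
  <<s past_gen Sigma nu p k >> K ->
  \int[Pr]_(w in K) (B (x k.+1 w) (p w k.+1))%:E <=
  \int[Pr]_(w in K) (kappa * B (x k w) (p w k) + psi)%:E.
Proof.
move=> hnu sK; have mK := past_sigma_measurable sK.
have mq l s : measurable [set w | p w l = s] by exact: adm_measurable_mode hadm _ _.
have mB l : measurable_fun setT (fun w => (B (x l w) (p w l))%:E).
  by apply/measurable_EFinP; exact: measurable_barrier_process.
have mBk : measurable_fun setT (fun w => (kappa * B (x k w) (p w k) + psi)%:E).
  apply/measurable_EFinP; apply: measurable_funD => //.
  by apply: measurable_funM => //; exact: measurable_barrier_process.
have Bk0 w : 0 <= (kappa * B (x k w) (p w k) + psi)%:E.
  have /andP[/ltW k0 _] := cbc_kappa hB.
  rewrite lee_fin addr_ge0//; last exact: cbc_psi hB.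
  by rewrite mulr_ge0// barrier_ge0.
rewrite (@ge0_integral_partition _ _ _ _ _ (p^~ k))//; last first.
  by move=> w; rewrite lee_fin barrier_ge0.
rewrite [leRHS](@ge0_integral_partition _ _ _ _ _ (p^~ k))//.
apply: lee_sum => q _; set D := K `&` [set w | p w k = q].
have sD : <<s past_gen Sigma nu p k >> D.
  apply: (@measurableI _ (g_sigma_algebraType (past_gen Sigma nu p k))) => //.
  exact (adapted_mode (@subset_refl _ _) q (leqnn k)).
have mD := past_sigma_measurable sD.
rewrite (@ge0_integral_partition _ _ _ _ _ (p^~ k.+1))//; last first.
  by move=> w; rewrite lee_fin barrier_ge0.
rewrite (eq_bigr _ (fun q' _ => integral_transition q' sD (@subIsetr _ _ _))).
have EZ q' : (ss_pi Sigma q q')%:E * \int[Pr]_(w in D) expected_barrier k q q' w =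
    \int[Pr]_(w in D) ((ss_pi Sigma q q')%:E * expected_barrier k q q' w).
  rewrite ge0_integralZl_EFin//; last exact: ss_pi_ge0.
  exact: measurable_funTS.
rewrite (eq_bigr _ (fun q' _ => EZ q')).
rewrite -ge0_integral_sum//; last 2 first.
- by move=> q'; apply: measurable_funeM; exact: measurable_funTS.
- by move=> q' w _; rewrite mule_ge0// lee_fin ss_pi_ge0.
(* The input satisfies [cbc_step] only almost surely. *)
apply: ae_ge0_le_integral => //.
- by move=> w _; apply: sume_ge0 => q' _; rewrite mule_ge0// lee_fin ss_pi_ge0.
- apply: emeasurable_sum => q'.
  by apply: measurable_funeM; exact: measurable_funTS.
- exact: measurable_funTS.
apply: filterS (hnu k) => w step [_ /= wq].
by move: step; rewrite /cbc_step wq.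
Qed.

End System.

(** * Probability that the barrier reaches [lambda] *)

Section Hitting.
Context d (Omega : measurableType d) (R : realType) (Pr : probability Omega R).
Context dV (V : measurableType dV) (n mbar N : nat) (m : 'I_N -> nat).
Context (Sigma : switching_system Pr V n mbar m).
Context (nu : nat -> {RV Pr >-> borelRn R mbar}) (p : Omega -> nat -> modes m).
Context (hadm : admissible Sigma nu p).
Context (a : borelRn R n) (Xa : ss_X Sigma a).
Context (B : borelRn R n -> modes m -> R) (kappa gamma lambda psi : R).
Context (X0 Xu : set (borelRn R n)).
Context (hB : is_CBC Sigma X0 Xu B kappa gamma lambda psi).
Context (hnu : realizes_CBC Sigma nu p B kappa psi a).
Notation x := (solution Sigma nu p a).

Definition high_barrier (k : nat) : set Omega :=
  [set w | lambda <= B (x k w) (p w k)].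

(** Time [k] is excluded: [hit k 0] is empty, and raising the horizon peels off time [k.+1]. *)
Definition hit (k j : nat) : set Omega :=
  \bigcup_(i in [set i | (k < i <= k + j)%N]) high_barrier i.

Local Open Scope ereal_scope.

Lemma adapted_high_barrier k : <<s past_gen Sigma nu p k >> (high_barrier k).
Proof.
have mB := adapted_barrier hadm Xa hB (@subset_refl _ (past_gen Sigma nu p k)).
have -> : high_barrier k = setT `&` (fun w => B (x k w) (p w k)) @^-1` `[lambda, +oo[.
  by rewrite setTI; apply/seteqP; split=> w /=; rewrite in_itv/= andbT.
by apply: mB => //; exact: measurable_itv.
Qed.

Lemma measurable_hit k j : measurable (hit k j).
Proof.
apply: bigcup_measurable => i _.
by have /(past_sigma_measurable hadm) := @adapted_high_barrier i.
Qed.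

Lemma hitS k j : hit k j.+1 = high_barrier k.+1 `|` hit k.+1 j.
Proof.
rewrite /hit; apply/seteqP; split=> [w [i /= /andP[ki ij] wi]|w [wk|[i /= /andP[ki ij] wi]]].
- have [ik|ik] := eqVneq k.+1 i; first by left; rewrite ik.
  by right; exists i => //=; rewrite ltn_neqAle ik ki addSnnS.
- by exists k.+1 => //=; rewrite leqnn addnS ltnS leq_addr.
- by exists i => //=; rewrite (ltnW ki) -addSnnS.
Qed.

(** The last two hypotheses are the coefficientwise form of v_j(kappa b + psi) <= v_(j+1)(b);
    [al_be_lambda] is v_j >= 1 at [lambda], and [al0] extends it beyond. *)
Variables al be : nat -> R.
Hypothesis al0 : forall j, (0 <= al j)%R.
Hypothesis be0 : forall j, (0 <= be j)%R.
Hypothesis al_be_lambda : forall j, (1 <= al j * lambda + be j)%R.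
Hypothesis alS : forall j, (al j * kappa <= al j.+1)%R.
Hypothesis beS : forall j, (al j * psi + be j <= be j.+1)%R.

Let v j k w := (al j * B (x k w) (p w k) + be j)%:E.

Let v0 j k w : 0 <= v j k w.
Proof. by rewrite lee_fin addr_ge0// mulr_ge0// (barrier_ge0 hadm Xa hB). Qed.

Let mv j k : measurable_fun setT (v j k).
Proof.
apply/measurable_EFinP; apply: measurable_funD => //.
by apply: measurable_funM => //; exact: (measurable_barrier_process hadm Xa hB).
Qed.

Let v_drift j k K : <<s past_gen Sigma nu p k >> K ->
  \int[Pr]_(w in K) v j k.+1 w <= \int[Pr]_(w in K) v j.+1 k w.
Proof.
move=> sK; have mK := past_sigma_measurable hadm sK.
have B0 l w := barrier_ge0 hadm Xa hB l w.
have mB l : measurable_fun K (fun w => (B (x l w) (p w l))%:E).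
  apply: measurable_funTS; apply/measurable_EFinP.
  exact: (measurable_barrier_process hadm Xa hB).
have /andP[/ltW k0 _] := cbc_kappa hB; have psi0 := cbc_psi hB.
(* The drift inequality bounds integrals of the barrier, not its values; an affine v_j lets it pass
   through the integral. *)
have affine (f : Omega -> R) : measurable_fun K (EFin \o f) ->
    (forall w, (0 <= f w)%R) ->
    \int[Pr]_(w in K) (al j * f w + be j)%:E =
    (al j)%:E * \int[Pr]_(w in K) (f w)%:E + (be j)%:E * Pr K.
  move=> mf f0; rewrite -integral_cst// -ge0_integralZl_EFin//; last 1 first.
    by move=> w _; rewrite lee_fin.
  rewrite -ge0_integralD//.
  - by move=> w _; rewrite lee_fin mulr_ge0.
  - exact: measurable_funeM.
  - by move=> w _; rewrite lee_fin.
rewrite affine//; last exact: mB.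
have mD : measurable_fun K (EFin \o (fun w => kappa * B (x k w) (p w k) + psi)%R).
  apply: measurable_funTS; apply/measurable_EFinP; apply: measurable_funD => //.
  by apply: measurable_funM => //; exact: (measurable_barrier_process hadm Xa hB).
apply: (@le_trans _ _
    (\int[Pr]_(w in K) (al j * (kappa * B (x k w) (p w k) + psi) + be j)%:E)).
  rewrite affine//; last first.
    by move=> w; rewrite addr_ge0// mulr_ge0.
  by rewrite leeD2r// lee_wpmul2l// ?lee_fin//; exact: (barrier_drift hadm Xa hB).
apply: ge0_le_integral => //.
- by move=> w _; rewrite lee_fin addr_ge0// mulr_ge0// addr_ge0// mulr_ge0.
- apply/measurable_EFinP; apply: measurable_funD => //.
  by apply: measurable_funM => //; exact/measurable_EFinP.
- exact: measurable_funTS.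
- move=> w _; rewrite lee_fin mulrDr mulrA -addrA lerD//.
  by rewrite ler_wpM2r.
Qed.

Lemma hit_bound j k K : <<s past_gen Sigma nu p k >> K ->
  Pr (K `&` hit k j) <= \int[Pr]_(w in K) (al j * B (x k w) (p w k) + be j)%:E.
Proof.
rewrite -/(v _ _ _); elim: j k K => [|j IH] k K sK.
  have -> : hit k 0 = set0.
    by apply/seteqP; split=> // w [i /=]; rewrite addn0; case: ltngtP.
  by rewrite setI0 measure0; apply: integral_ge0 => w _; exact: v0.
apply: le_trans (v_drift j sK).
have mK := past_sigma_measurable hadm sK.
have sU := @adapted_high_barrier k.+1; have mU := past_sigma_measurable hadm sU.
set U := high_barrier k.+1 in sU mU *.
have mH := measurable_hit k.+1 j.
have sK' : <<s past_gen Sigma nu p k.+1 >> K.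
  by apply: sub_sigma_algebra2 sK; exact: past_le.
have sKU : <<s past_gen Sigma nu p k.+1 >> (K `\` U).
  exact: (@measurableD _ (g_sigma_algebraType (past_gen Sigma nu p k.+1))).
(* On [U] the level is already reached at time [k.+1]; off [U] the induction hypothesis applies from
   there with horizon [j]. *)
have KE : K `&` hit k j.+1 = (K `&` U) `|` ((K `\` U) `&` hit k.+1 j).
  rewrite hitS -/U; apply/seteqP; split=> [w [Kw Uw]|w [[Kw Uw]|[[Kw Uw] hw]]].
  - have [wU|wU] := pselect (U w); first by left.
    by right; case: Uw.
  - by split=> //; left.
  - by split=> //; right.
have mKU := measurableI _ _ mK mU; have mKDU := measurableD mK mU.
rewrite KE (le_trans (measureU2 _ _ _))//; first exact: measurableI.
have -> : \int[Pr]_(w in K) v j k.+1 w =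
    \int[Pr]_(w in (K `&` U) `|` (K `\` U)) v j k.+1 w by rewrite setUIDK.
rewrite ge0_integral_setU//.
- rewrite leeD//; last exact: IH.
  (* On [U] the barrier is at least [lambda], so v_j >= 1 and the integral dominates the
     probability. *)
  rewrite -[leLHS]mul1e -integral_cst//; apply: ge0_le_integral => //.
  + exact: measurable_funTS.
  + move=> w [_ /= lw]; rewrite lee_fin (le_trans (al_be_lambda j))//.
    by rewrite lerD2r ler_wpM2l.
- exact: measurable_funTS.
- by rewrite disj_set2E setDE setIACA setICr setI0.
Qed.

End Hitting.

(** * Affine coefficients for the two regimes of [delta] *)

Lemma delta_affine (R : realType) (kappa lambda psi : R) :
  0 < kappa < 1 -> 0 < lambda -> 0 <= psi ->
  exists al be : nat -> R,
    [/\ forall j, 0 <= al j, forall j, 0 <= be j,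
        forall j, 1 <= al j * lambda + be j,
        forall j, al j * kappa <= al j.+1 &
        forall j, al j * psi + be j <= be j.+1] /\
    forall gamma T, delta kappa gamma lambda psi T = al T * gamma + be T.
Proof.
move=> /andP[k0 k1] l0 psi0.
have [psil|psil] := leP (psi / (1 - kappa)) lambda.
  (* [al j * b + be j = 1 - (1 - b / lambda) * c ^+ j] *)
  pose c := 1 - psi / lambda.
  (* The regime condition is used here: [kappa <= c] gives the recursion on [al]. The recursion on
     [be] and the condition at [lambda] hold with equality. *)
  have kc : kappa <= c.
    have : psi / lambda <= 1 - kappa.
      by rewrite ler_pdivrMr// mulrC -ler_pdivrMr ?subr_gt0.
    by rewrite /c; lra.
  have c0 : 0 <= c by rewrite (le_trans _ kc)// ltW.
  have c1 : c <= 1 by rewrite /c gerBl divr_ge0// ltW.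
  exists (fun j => c ^+ j / lambda), (fun j => 1 - c ^+ j); split; first split.
  - by move=> j; rewrite divr_ge0 ?exprn_ge0// ltW.
  - by move=> j; rewrite subr_ge0 exprn_ile1.
  - by move=> j; rewrite divfK ?gt_eqF// addrC subrK.
  - move=> j; rewrite mulrAC exprSr ler_wpM2r ?invr_ge0 ?(ltW l0)//.
    by rewrite ler_wpM2l// exprn_ge0.
  - by move=> j; rewrite exprSr {3}/c mulrBr mulr1 opprB -mulrA (mulrC lambda^-1); lra.
  - by move=> gamma T; rewrite /delta psil -/c; ring.
(* [al j * b + be j = b / lambda * kappa ^+ j + s * (1 - kappa ^+ j)] *)
pose s := psi / ((1 - kappa) * lambda).
have k10 : 0 < 1 - kappa by rewrite subr_gt0.
(* [s] is the fixed point of b -> kappa b + psi in units of [lambda]. Both recursions are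
   equalities, and [s1], which uses the regime condition, gives the bound at [lambda]. *)
have s1 : 1 <= s.
  by rewrite /s invfM mulrA lter_pdivlMr// mul1r ltW.
have psiE : psi / lambda = s * (1 - kappa).
  by rewrite /s; field; rewrite !gt_eqF.
have kj0 j : 0 <= kappa ^+ j by rewrite exprn_ge0// ltW.
have kj1 j : kappa ^+ j <= 1 by rewrite exprn_ile1// ltW.
exists (fun j => kappa ^+ j / lambda), (fun j => s * (1 - kappa ^+ j)).
split; first split.
- by move=> j; rewrite divr_ge0// ltW.
- by move=> j; rewrite mulr_ge0 ?subr_ge0// (le_trans _ s1).
- move=> j; rewrite divfK ?gt_eqF//.
  have := kj1 j; nra.
- by move=> j; rewrite mulrAC exprSr.
- move=> j; rewrite mulrAC -mulrA psiE exprSr; lra.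
- by move=> gamma T; rewrite /delta leNgt psil /= -/s; ring.
Qed.

Theorem theorem3p2 (d : measure_display) (Omega : measurableType d)
    (R : realType) (Pr : probability Omega R)
    (dV : measure_display) (V : measurableType dV)
    (n mbar N : nat) (m : 'I_N -> nat)
    (Sigma : switching_system Pr V n mbar m)
    (X0 Xu : set (borelRn R n))
    (hX0 : X0 `<=` ss_X Sigma) (hXu : Xu `<=` ss_X Sigma)
    (B : borelRn R n -> modes m -> R) (kappa gamma lambda psi : R)
    (hB : is_CBC Sigma X0 Xu B kappa gamma lambda psi)
    (nu : nat -> {RV Pr >-> borelRn R mbar}) (p : Omega -> nat -> modes m)
    (hadm : admissible Sigma nu p)
    (a : borelRn R n) (ha : X0 a)
    (hnu : realizes_CBC Sigma nu p B kappa psi a)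
    (p0 : modes m) (hp0 : (0 < Pr [set w | p w 0%N = p0])%E)
    (T : nat) (hreach : measurable (reach Sigma nu p Xu a T)) :
  cond_prob Pr (reach Sigma nu p Xu a T) [set w | p w 0%N = p0]
    <= delta kappa gamma lambda psi T.
Proof.
have lambda0 : 0 < lambda := le_lt_trans (cbc_gamma hB) (cbc_gap hB).
have [al [be [[al0 be0 albe alS beS] ->]]] :=
  delta_affine (cbc_kappa hB) lambda0 (cbc_psi hB).
set A := [set w | p w 0%N = p0] in hp0 *.
have mA : measurable A by exact: adm_measurable_mode hadm _ _.
(* The initial mode belongs to the past at time 0, so [hit_bound] applies with [A] as the event
   [K]. *)
have sA : <<s past_gen Sigma nu p 0 >> A.
  exact (adapted_mode (@subset_refl _ _) p0 (leqnn 0)).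
have Xa := hX0 _ ha.
have AE : (\int[Pr]_(w in A)
    (al T * B (solution Sigma nu p a 0 w) (p w 0%N) + be T)%:E <=
    (al T * gamma + be T)%:E * Pr A)%E.
  rewrite -integral_cst//; apply: ge0_le_integral => //.
  - move=> w _; rewrite lee_fin addr_ge0// mulr_ge0//.
    exact: cbc_ge0 hB _ _ Xa.
  - apply/measurable_EFinP; apply: measurable_funD => //.
    apply: measurable_funM => //; apply: measurable_funTS.
    exact: (measurable_barrier_process hadm Xa hB).
  - move=> w _; rewrite lee_fin lerD2r ler_wpM2l//.
    exact: cbc_init hB _ _ ha.
have reach_hit : reach Sigma nu p Xu a T `&` A `<=`
    A `&` hit Sigma nu p a B lambda 0 T.
  move=> w [[k kT Xuk] Aw]; split=> //; exists k.
    (* [hit] omits time 0; a start inside [Xu] would give lambda <= B <= gamma, against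
       [cbc_gap]. *)
    rewrite /= kT andbT lt0n; apply/eqP => k0; move: Xuk; rewrite k0 /= => Xua.
    have := le_trans (cbc_unsafe hB p0 Xua) (cbc_init hB p0 ha).
    by rewrite leNgt (cbc_gap hB).
  exact: cbc_unsafe hB _ _ Xuk.
have mH := measurable_hit hadm Xa hB 0 T.
have PA := fin_num_measure Pr _ mA.
have main : (Pr (reach Sigma nu p Xu a T `&` A) <=
    (al T * gamma + be T)%:E * Pr A)%E.
  apply: le_trans AE.
  apply: le_trans (hit_bound hadm Xa hB hnu al0 be0 albe alS beS T sA).
  by apply: le_measure => //; rewrite inE; exact: measurableI.
rewrite /cond_prob ler_pdivrMr; last by rewrite fine_gt0// hp0 ltey_eq PA.
rewrite -lee_fin EFinM !fineK//.
by apply: fin_num_measure; exact: measurableI.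
Qed.
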